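(* Let $\Omega\subset\mathbb{R}^n$ be open and bounded, $N\in\mathbb{N}$, $u^c,u^\eta\in L^2(\Omega;\mathbb{R}^N)$. Let $\Lambda$ be a nonempty subset of a first countable topological space $X$ with compact closure $\overline\Lambda$, and for each $\lambda\in\Lambda$ let $\mathcal{R}_\lambda:L^2(\Omega)\to[0,\infty]$ be weakly $L^2$-lower semicontinuous with $\{v\in L^2(\Omega):\mathcal{R}_\lambda(v)<\infty\}\ne\emptyset$. For $\lambda\in\Lambda$ and $j\in\{1,\dots,N\}$ set $\mathcal{J}_{\lambda,j}(u)=\|u-u^\eta_j\|^2_{L^2(\Omega)}+\mathcal{R}_\lambda(u)$ for $u\in L^2(\Omega)$. Assume that for all $\lambda\in\overline\Lambda$ and all $j$ the $\Gamma$-limit $\overline{\mathcal{J}}_{\lambda,j}:=\Gamma(w\text{-}L^2)\text{-}\lim_{\lambda'\to\lambda}\mathcal{J}_{\lambda',j}$ exists ($\lambda'$ taking values on arbitrary sequences in $\Lambda$), that the Mosco-limit $\overline{\mathcal{R}}_\lambda:=\mathrm{Mosc}(L^2)\text{-}\lim_{\lambda'\to\lambda}\mathcal{R}_{\lambda'}$ exists for each $\lambda\in\overline\Lambda$ ($\lambda'$ taking values on sequences in $\Lambda$), and that $\overline{K}_\lambda$ is a singleton for every $\lambda\in\overline\Lambda\setminus\Lambda$. With $\mathcal{I}$ and $\overline{\mathcal{I}}$ as defined in the context, it holds that: (i) The extension $\overline{\mathcal{I}}$ has at least one minimizer and $\min_{\overline\Lambda}\overline{\mathcal{I}}=\inf_\Lambda\mathcal{I}$.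 (ii) Any minimizing sequence $(\lambda_k)_k\subset\Lambda$ of $\mathcal{I}$ converges up to subsequence to a minimizer $\lambda\in\overline\Lambda$ of $\overline{\mathcal{I}}$. (iii) If $\lambda\in\Lambda$ minimizes $\overline{\mathcal{I}}$, then $\lambda$ is also a minimizer of $\mathcal{I}$.
   Context: Norm convention: $\|v\|^2_{L^2(\Omega;\mathbb{R}^N)}=\sum_{j=1}^N\|v_j\|^2_{L^2(\Omega)}$. $\Gamma$- and Mosco-convergence: for $\mathcal{F}_k,\mathcal{F}:L^2(\Omega)\to[0,\infty]$, $\mathcal{F}=\Gamma(w\text{-}L^2)\text{-}\lim_{k}\mathcal{F}_k$ means: (liminf inequality) whenever $u_k\rightharpoonup u$ weakly in $L^2(\Omega)$, $\mathcal{F}(u)\le\liminf_k\mathcal{F}_k(u_k)$; and (limsup inequality) for every $u\in L^2(\Omega)$ there is $u_k\rightharpoonup u$ weakly in $L^2(\Omega)$ with $\mathcal{F}(u)\ge\limsup_k\mathcal{F}_k(u_k)$. If, in addition, the sequence in the limsup inequality can be chosen to converge strongly in $L^2(\Omega)$, then $\mathcal{F}=\mathrm{Mosc}(L^2)\text{-}\lim_k\mathcal{F}_k$. A limit ''$\lambda'\to\lambda$, with $\lambda'$ on sequences in $\Lambda$'' exists and equals $\mathcal{F}$ if for every sequence $(\lambda_k)_k\subset\Lambda$ with $\lambda_k\to\lambda$ the corresponding sequence of functionals converges to (the same) $\mathcal{F}$. Upper-level functional: for $\lambda\in\Lambda$, $\mathcal{I}(\lambda)=\inf_{w\in K_\lambda}\|w-u^c\|^2_{L^2(\Omega;\mathbb{R}^N)}$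 with $K_\lambda=\{w\in L^2(\Omega;\mathbb{R}^N):w_j\in\operatorname{arg\,min}_{u\in L^2(\Omega)}\mathcal{J}_{\lambda,j}(u)\ \forall j\}$. Extension: for $\lambda\in\overline\Lambda$, $\overline{K}_\lambda=\{w\in L^2(\Omega;\mathbb{R}^N):w_j\in\operatorname{arg\,min}_{u\in L^2(\Omega)}\overline{\mathcal{J}}_{\lambda,j}(u)\ \forall j\}$ and $\overline{\mathcal{I}}(\lambda)=\min_{w\in\overline{K}_\lambda}\|w-u^c\|^2_{L^2(\Omega;\mathbb{R}^N)}$. (The minimum is attained, and $\overline{\mathcal{J}}_{\lambda,j}=\mathcal{J}_{\lambda,j}$ for $\lambda\in\Lambda$.) A minimizing sequence of $\mathcal{I}$ is a sequence $(\lambda_k)_k\subset\Lambda$ with $\mathcal{I}(\lambda_k)\to\inf_\Lambda\mathcal{I}$. *)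

(* Defs.v *)
From HB Require Import structures.
From mathcomp Require Import all_boot all_order all_algebra.
From mathcomp Require Import all_classical all_reals all_analysis.

Set Implicit Arguments.
Unset Strict Implicit.
Unset Printing Implicit Defensive.

Import Order.TTheory GRing.Theory Num.Theory.
Import numFieldNormedType.Exports.

Local Open Scope classical_set_scope.
Local Open Scope ring_scope.

Section product_measure_tuple.
Context d (T : measurableType d) (R : realType).
Variable mu : {sigma_finite_measure set T -> \bar R}.

Definition tuple_of_pair n (p : T * n.-tuple T) : n.+1.-tuple T :=
  [tuple of p.1 :: p.2].

Definition pair_of_tuple n (t : n.+1.-tuple T) : T * n.-tuple T :=
  (thead t, [tuple of behead t]).

Lemma tuple_of_pairK n : cancel (@tuple_of_pair n) (@pair_of_tuple n).
Proof. by move=> [x t]; congr pair; apply/val_inj. Qed.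

Lemma measurable_tuple_of_pair n :
  measurable_fun [set: T * n.-tuple T] (@tuple_of_pair n).
Proof. exact: measurable_cons. Qed.

Lemma measurable_pair_of_tuple n :
  measurable_fun [set: n.+1.-tuple T] (@pair_of_tuple n).
Proof.
apply: measurable_fun_pair; first exact: measurable_tnth.
exact: measurable_behead.
Qed.

Section step.
Variables (n : nat) (m : {sigma_finite_measure set (n.-tuple T) -> \bar R}).

Definition product_measure_cons : set (n.+1.-tuple T) -> \bar R :=
  pushforward (mu \x m)%E (@tuple_of_pair n).

Local Notation pmc := product_measure_cons.

Let pmc0 : pmc set0 = 0%E.
Proof. by rewrite /pmc /pushforward preimage_set0 measure0. Qed.

Let pmc_ge0 A : (0 <= pmc A)%E.
Proof. by rewrite /pmc /pushforward measure_ge0. Qed.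

Let pmc_sigma_additive : semi_sigma_additive pmc.
Proof.
apply: (@measure_semi_sigma_additive _ _ _ (pushforward _ _)).
exact: measurable_tuple_of_pair.
Qed.

HB.instance Definition _ := isMeasure.Build _ _ _ pmc
  pmc0 pmc_ge0 pmc_sigma_additive.

Let pmc_sigma_finite : sigma_finite setT pmc.
Proof.
have /sigma_finiteP[F [TF ndF Foo]] := sigma_finiteT mu.
have /sigma_finiteP[G [TG ndG Goo]] := sigma_finiteT m.
exists (fun k => @pair_of_tuple n @^-1` (F k `*` G k)).
  rewrite -preimage_bigcup; apply/esym/seteqP; split=> // t _ /=.
  have [i _ Fi] : (\bigcup_i F i) (thead t) by rewrite -TF.
  have [j _ Gj] : (\bigcup_i G i) [tuple of behead t] by rewrite -TG.
  exists (maxn i j) => //; split=> /=.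
    by move: Fi; exact/subsetPset/ndF/leq_maxl.
  by move: Gj; exact/subsetPset/ndG/leq_maxr.
move=> k; have [mF Fk] := Foo k; have [mG Gk] := Goo k; split.
  rewrite -[X in measurable X]setTI.
  by apply: measurable_pair_of_tuple => //; exact: measurableX.
rewrite /pmc /pushforward -comp_preimage.
rewrite (_ : _ \o _ = idfun); last first.
  by apply/funext => p /=; rewrite tuple_of_pairK.
rewrite preimage_id product_measure1E//.
by rewrite lte_mul_pinfty// ge0_fin_numE.
Qed.

HB.instance Definition _ := Measure_isSigmaFinite.Build _ _ _ pmc
  pmc_sigma_finite.

End step.

Fixpoint product_measure_tuple n :
    {sigma_finite_measure set (n.-tuple T) -> \bar R} :=
  if n is n'.+1 then product_measure_cons (product_measure_tuple n')
  else \d_([tuple] : 0.-tuple T).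

Lemma product_measure_tupleE n (A : 'I_n -> set T) :
  (forall i, measurable (A i)) ->
  product_measure_tuple n [set t | forall i, A i (tnth t i)] =
    (\prod_(i < n) mu (A i))%E.
Proof.
elim: n A => [A _|n IH A mA].
  rewrite big_ord0 /= diracE mem_set//= => -[].
  by [].
rewrite big_ord_recl -IH//= /product_measure_cons /pushforward.
rewrite -product_measure1E//.
  congr (product_measure1 _ _ _); apply/seteqP; split=> [[x t] /= H|[x t] /= [Ax At] i].
    by split=> [|i]; [have := H ord0|have := H (lift ord0 i); rewrite tnthS].
  have [->//|/eqP] := eqVneq i ord0.
  case: (unliftP ord0 i) => [j ->|->//] _.
  by rewrite tnthS; have := At j.
rewrite (_ : mkset _ = \bigcap_(i in [set: 'I_n])
    ((fun t : n.-tuple T => tnth t i) @^-1` A (lift ord0 i))).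
  apply: fin_bigcap_measurable => // i _; rewrite -[X in measurable X]setTI.
  exact: measurable_tnth.
by apply/seteqP; split=> t /= H i; [move=> _; exact: H|exact: (H i)].
Qed.

End product_measure_tuple.

Section lebesgue_rV.
Context (R : realType) (n : nat).

(* R^n with its Borel sigma-algebra *)
Definition borel_rV := g_sigma_algebraType (@open 'rV[R]_n).

Definition rV_of_tuple (t : n.-tuple (measurableTypeR R)) : borel_rV :=
  (\row_i tnth t i : 'rV[R]_n).

Lemma open_measurable_rV (U : set 'rV[R]_n) :
  open U -> measurable (U : set borel_rV).
Proof. exact: sub_sigma_algebra. Qed.

Lemma measurable_rV_of_tuple : measurable_fun [set: _] rV_of_tuple.
Proof.
apply: (@measurability _ _ _ borel_rV setT rV_of_tuple (@open 'rV[R]_n)) => //.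
move=> _ [U oU <-]; rewrite setTI.
pose q (c : {ffun 'I_n -> rat}) : 'rV[R]_n := \row_i ratr (c i).
pose B (p : {ffun 'I_n -> rat} * nat) : set 'rV[R]_n :=
  ball (q p.1) (p.2.+1%:R^-1).
rewrite (_ : _ @^-1` U =
    \bigcup_(p in [set p | B p `<=` U]) rV_of_tuple @^-1` B p); last first.
  rewrite -preimage_bigcup; congr (_ @^-1` _); apply/seteqP; split; last first.
    by move=> x [p pU /pU].
  move=> x Ux; have /nbhs_ballP[e /= e0 xeU] : nbhs x U by exact: open_nbhs_nbhs.
  have [k ke] : exists k : nat, k.+1%:R^-1 < e / 2.
    have e20 : 0 < e / 2 by exact: divr_gt0.
    have [k _ /(_ k (leqnn k))] := near_infty_natSinv_lt (PosNum e20).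
    by exists k.
  have /choice[c cP] (i : 'I_n) : exists r : rat, `|x ord0 i - ratr r| < k.+1%:R^-1.
    have : (x ord0 i - k.+1%:R^-1 < x ord0 i + k.+1%:R^-1 :> R).
      by rewrite ltrD2l gt0_cp// invr_gt0.
    move=> /rat_in_itvoo[r]; rewrite in_itv/= => /andP[r1 r2].
    by exists r; rewrite ltr_distlC r1 r2.
  have Bx : B ([ffun i => c i], k) x.
    split; first by rewrite invr_gt0.
    by move=> i j; rewrite ord1 /q !mxE ffunE /ball/= distrC.
  exists ([ffun i => c i], k) => //= y By; apply: xeU.
  by apply: (ball_split (z := q [ffun i => c i])); [apply: ball_sym|];
    apply: le_ball By || apply: le_ball Bx; exact: ltW.
rewrite bigcup_mkcond; apply: countable_bigcupT_measurable => // p.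
case: ifPn => // _.
rewrite (_ : _ @^-1` _ = \bigcap_(i in [set: 'I_n])
    (fun t : n.-tuple (measurableTypeR R) => tnth t i) @^-1`
      ball (ratr (p.1 i) : R) (p.2.+1%:R^-1)).
  apply: fin_bigcap_measurable => // i _; rewrite -[X in measurable X]setTI.
  by apply: measurable_tnth => //; rewrite ball_itv; exact: measurable_itv.
apply/seteqP; split=> t /=.
  by move=> [_ H] i _; have := H ord0 i; rewrite !mxE.
move=> H; split; first by rewrite invr_gt0.
by move=> i j; rewrite !mxE; exact: H.
Qed.

Definition lebesgue_rV : set borel_rV -> \bar R :=
  pushforward (product_measure_tuple (@lebesgue_measure R) n) rV_of_tuple.

Let lebesgue_rV0 : lebesgue_rV set0 = 0%E.
Proof. by rewrite /lebesgue_rV /pushforward preimage_set0 measure0. Qed.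

Let lebesgue_rV_ge0 A : (0 <= lebesgue_rV A)%E.
Proof. by rewrite /lebesgue_rV /pushforward measure_ge0. Qed.

Let lebesgue_rV_sigma_additive : semi_sigma_additive lebesgue_rV.
Proof.
apply: (@measure_semi_sigma_additive _ _ _ (pushforward _ _)).
exact: measurable_rV_of_tuple.
Qed.

HB.instance Definition _ := isMeasure.Build _ _ _ lebesgue_rV
  lebesgue_rV0 lebesgue_rV_ge0 lebesgue_rV_sigma_additive.

Lemma lebesgue_rV_box (a b : 'I_n -> R) : (forall i, a i <= b i) ->
  lebesgue_rV [set x : 'rV[R]_n | forall i, a i < x ord0 i <= b i] =
    (\prod_(i < n) (b i - a i))%:E.
Proof.
move=> ab.
rewrite -prodEFin.
under eq_bigr => i _.
  rewrite (_ : (b i - a i)%:E = lebesgue_measure `]a i, b i]%classic); last first.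
    rewrite lebesgue_measure_itv/= lte_fin; case: ltP => [//|ba].
    by rewrite (@le_anti _ _ (a i) (b i)) ?ab// subrr.
  over.
rewrite -product_measure_tupleE//.
rewrite /lebesgue_rV /pushforward; apply: (congr1 (product_measure_tuple _ n)).
apply/seteqP; split=> t /= H i; have := H i; rewrite mxE//=.
Qed.

End lebesgue_rV.

Definition lebesgue_on (R : realType) n (Omega : set 'rV[R]_n)
    (oOmega : open Omega) : set (borel_rV R n) -> \bar R :=
  mrestr (@lebesgue_rV R n) (open_measurable_rV oOmega).

HB.instance Definition _ (R : realType) n (Omega : set 'rV[R]_n)
  (oOmega : open Omega) := Measure.on (lebesgue_on oOmega).

(* The space L^2(Omega): functions on R^n up to equality a.e. for the Lebesgue
   measure restricted to Omega are functions on Omega up to equality a.e. *)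
Definition L2 (R : realType) n (Omega : set 'rV[R]_n) (oOmega : open Omega) :=
  LspaceType2 (lebesgue_on oOmega).

Section L2_functionals.
Context d (T : measurableType d) (R : realType).
Variable mu : {measure set T -> \bar R}.
Local Notation L2mu := (LspaceType2 mu).
Local Open Scope ereal_scope.

Definition L2dist (u v : L2mu) : \bar R :=
  'N[mu]_2%:E[EFin \o (u \- v)%R].

Definition L2prod (u v : L2mu) : \bar R := \int[mu]_x (u x * v x)%:E.

Definition strong_cvg (u_ : nat -> L2mu) (u : L2mu) : Prop :=
  L2dist (u_ k) u @[k --> \oo] --> 0.

Definition weak_cvg (u_ : nat -> L2mu) (u : L2mu) : Prop :=
  forall v : L2mu, L2prod (u_ k) v @[k --> \oo] --> L2prod u v.

Definition weak_lsc (F : L2mu -> \bar R) : Prop :=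
  forall (u_ : nat -> L2mu) (u : L2mu),
    weak_cvg u_ u -> F u <= limn_einf (F \o u_).

Definition gamma_liminf (F_ : nat -> L2mu -> \bar R) (F : L2mu -> \bar R) :=
  forall (u_ : nat -> L2mu) (u : L2mu),
    weak_cvg u_ u -> F u <= limn_einf (fun k => F_ k (u_ k)).

Definition gamma_lim (F_ : nat -> L2mu -> \bar R) (F : L2mu -> \bar R) :=
  gamma_liminf F_ F /\
  forall u : L2mu, exists2 u_ : nat -> L2mu,
    weak_cvg u_ u & limn_esup (fun k => F_ k (u_ k)) <= F u.

Definition mosco_lim (F_ : nat -> L2mu -> \bar R) (F : L2mu -> \bar R) :=
  gamma_lim F_ F /\
  forall u : L2mu, exists2 u_ : nat -> L2mu,
    strong_cvg u_ u & limn_esup (fun k => F_ k (u_ k)) <= F u.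

(* L^2(Omega; R^N), as the N-tuples of elements of L^2(Omega). *)
Definition vL2dist2 N (w v : 'I_N -> L2mu) : \bar R :=
  \sum_(j < N) L2dist (w j) (v j) ^+ 2.

End L2_functionals.

(* A limit of functionals G lambda' as lambda' -> lambda in Lam: the limit in
   the sense lim_ along every sequence in Lam that converges to lambda. *)
Definition lim_along (X : topologicalType) (Y : Type)
    (lim_ : (nat -> Y) -> Y -> Prop) (Lam : set X) (G : X -> Y) (lambda : X)
    (F : Y) : Prop :=
  forall l : nat -> X, (forall k, Lam (l k)) -> l @ \oo --> lambda ->
    lim_ (G \o l) F.

Definition argmin (Y : Type) (R : realType) (A : set Y) (F : Y -> \bar R) :=
  [set x | A x /\ forall y, A y -> (F x <= F y)%E].

Section bilevel.
Context d (T : measurableType d) (R : realType).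
Variable mu : {measure set T -> \bar R}.
Local Notation L2mu := (LspaceType2 mu).
Variables (N : nat) (uc ueta : 'I_N -> L2mu).
Local Open Scope ereal_scope.

Definition denoising (Reg : L2mu -> \bar R) (j : 'I_N) (u : L2mu) : \bar R :=
  L2dist u (ueta j) ^+ 2 + Reg u.

Definition minimizers (J : 'I_N -> L2mu -> \bar R) : set ('I_N -> L2mu) :=
  [set w | forall j, argmin setT (J j) (w j)].

(* The infimum defines I (J = J_lambda) as well as its extension (J the
   Gamma-limit), for which it is attained. *)
Definition upper_level (J : 'I_N -> L2mu -> \bar R) : \bar R :=
  ereal_inf [set vL2dist2 w uc | w in minimizers J].

End bilevel.

Definition first_countable (X : topologicalType) : Prop :=
  forall x : X, exists2 B : set_system X, countable B &
    B `<=` nbhs x /\ filter_from B id --> x.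

(* Main.v *)
Require Import Defs.
From mathcomp Require Import all_boot all_order all_algebra.
From mathcomp Require Import all_classical all_reals all_analysis.
From mathcomp Require Import measurable_realfun ring lra.

Set Implicit Arguments.
Unset Strict Implicit.
Unset Printing Implicit Defensive.

Import Order.TTheory GRing.Theory Num.Theory.
Import numFieldNormedType.Exports.

Local Open Scope classical_set_scope.
Local Open Scope ring_scope.

(** Everything rests on two semicontinuity facts for the extension [Ibar]
    (write [I] for the upper-level functional on [Lam]).

    - If [l k] tends to [l0], then [Ibar l0] is at most the lower limit of
      [I (l k)] ([extension_lsc]).  Almost optimal minimizers [w k] for [l k]
      stay at bounded distance from [uc], so a subsequence converges weakly;
      a weak limit of minimizers minimizes the Gamma-limit
      ([gamma_lim_argmin]), and the distance to [uc] is weakly lower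
      semicontinuous.
    - The infimum of [I] over [Lam] is at most [Ibar l0] for every [l0] in the
      closure ([inf_le_extension]).  On [Lam] the two functionals agree, because
      the Gamma-limit of a constant sequence of weakly lower semicontinuous
      functionals is that functional ([extensionE]).  At a boundary point,
      minimizers for a sequence tending to [l0] again converge weakly along a
      subsequence, and their limit is the only element [w] of the limiting
      solution set.  The Mosco-limit upgrades this to strong convergence
      ([mosco_argmin_strong]): comparing energies with a strong recovery
      sequence of [w] for the regularizers shows that the fidelity terms cannot
      exceed that of [w] in the limit, and weak convergence together with convergence of
      norms is strong convergence.  Hence the distances to [uc] converge to
      [Ibar l0].

    Since a compact set in a first countable space is sequentially compact,
    a minimizing sequence of [I] has a subsequence that converges in the closure,
    and the two facts force its limit to be a minimizer of [Ibar] with value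
    [inf I].  All three claims follow.

    The analytic input is that bounded sequences in L^2 have weakly convergent
    subsequences ([bounded_weak_cvg]).  It is proved for any complete semi-inner
    product: a diagonal argument makes all [ip (u (phi k)) (u m)] converge in
    [k], the vectors [y] for which [ip (u (phi k)) y] converges form a closed
    subspace, orthogonal projection shows that this subspace is everything, and
    the Riesz representation of the limit functional is the weak limit.
    Projection and representation are a single minimization argument
    ([riesz_subspace]).  Completeness is the Riesz-Fischer theorem
    ([riesz_fischer]).  Working with a semi-inner product allows functions to be
    used in place of their classes modulo almost everywhere equality. *)

(** * Lower and upper limits of extended real sequences *)

Section limn_einf_esup.
Context (R : realType).
Implicit Types (a : (\bar R)^nat) (c : \bar R).
Local Open Scope ereal_scope.

Lemma limn_einf_le a c : (\forall k \near \oo, a k <= c) -> limn_einf a <= c.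
Proof.
move=> ac; rewrite limn_einf_lim; apply: lime_le; first exact: is_cvg_einfs.
apply: filterS ac => k; apply: le_trans; apply: ereal_inf_lbound.
by exists k => /=.
Qed.

Lemma limn_einf_ge a c : (\forall k \near \oo, c <= a k) -> c <= limn_einf a.
Proof.
move=> [n _ ac]; rewrite limn_einf_lim; apply: lime_ge; first exact: is_cvg_einfs.
exists n => // k /= nk; apply: le_ereal_inf_tmp => _ [m /= km <-].
by apply: ac => /=; exact: leq_trans km.
Qed.

Lemma limn_einf_gt a c : c < limn_einf a -> \forall k \near \oo, c < a k.
Proof.
rewrite limn_einf_lim => ca.
have [n cn] : exists n, c < einfs a n.
  apply: contrapT => /forallNP nc; move: ca; apply/negP; rewrite -leNgt.
  apply: lime_le; first exact: is_cvg_einfs.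
  by apply: nearW => n; rewrite leNgt; exact/negP.
exists n => // k /= nk; apply: lt_le_trans cn _; apply: ereal_inf_lbound.
by exists k.
Qed.

Lemma limn_esup_lt a c : limn_esup a < c -> \forall k \near \oo, a k < c.
Proof.
rewrite -lteN2 -limn_einfN => /limn_einf_gt; apply: filterS => k /=.
by rewrite lteN2.
Qed.

Lemma limn_einf_mono a b : (\forall k \near \oo, a k <= b k) ->
  limn_einf a <= limn_einf b.
Proof.
move=> [N _ ab]; rewrite !limn_einf_lim; apply: lee_lim; try exact: is_cvg_einfs.
exists N => // n /= Nn; apply: le_ereal_inf_tmp => _ [k /= nk <-].
apply: le_trans (ab k (leq_trans Nn nk)).
by apply: ereal_inf_lbound; exists k.
Qed.

Lemma limn_einf_le_esup a b : (\forall k \near \oo, a k <= b k) ->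
  limn_einf a <= limn_esup b.
Proof. by move=> /limn_einf_mono/le_trans; apply; exact: limn_einf_sup. Qed.

(** Nonnegativity is what keeps the sums away from [+oo - oo]. *)
Lemma limn_einfD a b : (forall k, 0 <= a k) -> (forall k, 0 <= b k) ->
  limn_einf a + limn_einf b <= limn_einf (fun k => a k + b k).
Proof.
move=> a0 b0; rewrite !limn_einf_lim.
have e0 (u : (\bar R)^nat) : (forall k, 0 <= u k) -> 0 <= limn (einfs u).
  by move=> u0; rewrite -limn_einf_lim; apply: limn_einf_ge; exact: nearW.
rewrite -limeD; last 3 first.
- exact: is_cvg_einfs.
- exact: is_cvg_einfs.
- by apply: ge0_adde_def; rewrite inE e0.
apply: lee_lim; [|exact: is_cvg_einfs|].
  apply: is_cvgeD; [|exact: is_cvg_einfs|exact: is_cvg_einfs].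
  by apply: ge0_adde_def; rewrite inE e0.
apply: nearW => n; apply: le_ereal_inf_tmp => _ [k /= nk <-].
by apply: leeD; apply: ereal_inf_lbound; exists k.
Qed.

End limn_einf_esup.

(** * Subsequences in first countable spaces *)

Definition subseq_index (phi : nat -> nat) := {homo phi : i j / (i < j)%N}.

Lemma subseq_index_ge phi : subseq_index phi -> forall k, (k <= phi k)%N.
Proof. by move=> pi; elim=> // k IH; rewrite (leq_ltn_trans IH)// pi. Qed.

Lemma subseq_index_cvg phi : subseq_index phi -> phi @ \oo --> \oo.
Proof.
move=> pi A [N _ NA]; exists N => // k /= Nk; apply: NA => /=.
by rewrite (leq_trans Nk)// subseq_index_ge.
Qed.

Lemma subseq_index_comp phi psi :
  subseq_index phi -> subseq_index psi -> subseq_index (phi \o psi).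
Proof. by move=> hf hp i j ij; apply/hf/hp. Qed.

(** The single extraction argument: being a cluster point lets one choose, after
    any index, a term in the next prescribed neighbourhood.  It yields both
    sequential compactness and the diagonal subsequence. *)
Lemma cluster_subseq (X : topologicalType) (s : nat -> X) (x : X)
    (U : nat -> set X) :
  cluster (s @ \oo) x -> (forall k, nbhs x (U k)) ->
  exists2 phi, subseq_index phi & forall k, U k (s (phi k)).
Proof.
move=> sx xU.
have /choice[g gP] (km : nat * nat) : exists n, (km.2 < n)%N /\ U km.1 (s n).
  have [|_ [[n kn <-] Un]] := sx (s @` [set n | (km.2 < n)%N]) _ _ (xU km.1).
    by exists km.2.+1 => // n /= kn; exists n.
  by exists n.
pose phi := fix phi k := if k is k'.+1 then g (k, phi k') else g (0%N, 0%N).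
have phiS k : (phi k < phi k.+1)%N by have [] := gP (k.+1, phi k).
exists phi; last by case=> [|k]; [have [] := gP (0, 0)%N | have [] := gP (k.+1, phi k)].
by apply: homo_ltn => // y x0 z; exact: ltn_trans.
Qed.

Lemma filter_forall_lt (T : Type) (F : set_system T) (f : nat -> set T) n :
  Filter F -> (forall i, F (f i)) -> F [set x | forall i, (i < n)%N -> f i x].
Proof.
move=> FF Ff; elim: n => [|n IH]; first by apply: filterS filterT => x _ i.
apply: filterS2 IH (Ff n) => x fx fnx i; rewrite ltnS leq_eqVlt.
by case/predU1P => [->//|]; exact: fx.
Qed.

(** The finite intersections of a countable family of neighbourhoods give a
    sequence that ends up inside every neighbourhood, which is the form needed to
    read off convergence. *)
Lemma first_countable_base (X : topologicalType) (x : X) : first_countable X ->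
  exists U : nat -> set X, (forall k, nbhs x (U k)) /\
    forall W, nbhs x W -> \forall k \near \oo, U k `<=` W.
Proof.
move=> /(_ x)[B cB [Bx xB]].
have [b0 Bb0 _] : filter_from B id setT by apply: xB; exact: filterT.
have [b [bB Bb]] : exists b : nat -> set X, (forall k, B (b k)) /\
    forall V, B V -> exists k, b k = V.
  move/pfcard_geP: cB => [B0|[f]]; first by rewrite B0 in Bb0.
  exists f; split=> [k|V BV]; first exact: funS.
  by have /(_ V BV)[k _ <-] := @surj _ _ _ _ f; exists k.
exists (fun k => [set t | forall i, (i < k.+1)%N -> b i t]).
split=> [k|W /xB[V BV VW]].
  by apply: filter_forall_lt => i; exact: Bx.
have [k kV] := Bb V BV; exists k => // n /= kn t bt; apply: VW.
by rewrite -kV; exact: bt.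
Qed.

Lemma compact_subseq (X : topologicalType) (A : set X) (s : nat -> X) :
  first_countable X -> compact A -> (forall k, A (s k)) ->
  exists2 phi, subseq_index phi & exists2 x, A x & s (phi k) @[k --> \oo] --> x.
Proof.
move=> X1 cA As; have [|x [Ax sx]] := cA (s @ \oo) _.
  by exists 0%N => // k _; exact: As.
have [U [xU Ux]] := first_countable_base x X1.
have [phi hphi phiU] := cluster_subseq sx xU.
exists phi => //; exists x => // W /Ux; apply: filterS => k; apply; exact: phiU.
Qed.

Lemma closure_seq (X : topologicalType) (A : set X) (x : X) :
  first_countable X -> closure A x ->
  exists2 s : nat -> X, forall k, A (s k) & s @ \oo --> x.
Proof.
move=> X1 Ax; have [U [xU Ux]] := first_countable_base x X1.
have /choice[s sP] k : exists y, A y /\ U k y by have [y []] := Ax _ (xU k); exists y.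
exists s => [k|W /Ux]; first by have [] := sP k.
by apply: filterS => k; apply; have [] := sP k.
Qed.

(** Tychonoff's theorem replaces the iterated extraction: the columns form a
    sequence in a product of segments, and the first [k + 1] coordinates of a cluster point can
    be approximated within [1 / (k + 1)] simultaneously. *)
Lemma bounded_diagonal_subseq (R : realType) (a : nat -> nat -> R) (C : nat -> R) :
  (forall m k, `|a m k| <= C m) ->
  exists2 phi, subseq_index phi & forall m, cvgn (fun k => a m (phi k)).
Proof.
move=> aC.
have cK : compact [set f : prod_topology (fun _ : nat => R) |
    forall m, [set` `[- C m, C m]%R] (f m)].
  apply: (@tychonoff _ (fun _ : nat => R) (fun m => [set` `[- C m, C m]%R])) => m.
  exact: segment_compact.
have [|f [_ cf]] := cK ((fun k => a ^~ k) @ \oo) _.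
  by exists 0%N => // k _ m /=; rewrite in_itv/= -ler_norml.
pose U k := [set g : prod_topology (fun _ : nat => R) |
  forall m, (m < k.+1)%N -> `|f m - g m| < k.+1%:R^-1].
have fU k : nbhs f (U k).
  apply: (@filter_forall_lt _ (nbhs f)
    (fun m => [set g | `|f m - g m| < k.+1%:R^-1])) => m.
  apply: (@proj_continuous _ (fun _ : nat => R) m f (ball (f m) k.+1%:R^-1)).
  by apply: nbhsx_ballx; rewrite invr_gt0.
have [phi hphi phiU] := cluster_subseq cf fU; exists phi => // m.
apply/cvg_ex; exists (f m); apply/cvgrPdist_lt => e e0; near=> k.
rewrite (lt_trans (phiU k m _))//; first by rewrite ltnS; near: k; exists m.
by near: k; exact: near_infty_natSinv_lt (PosNum e0).
Unshelve. all: by end_near. Qed.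

(** * Riesz representation and weak compactness for a complete semi-inner product *)

Lemma cvg_sqr0 (R : realType) (t : nat -> R) :
  t k ^+ 2 @[k --> \oo] --> 0 -> t @ \oo --> 0.
Proof.
move=> t0; apply/norm_cvg0P.
under eq_fun do rewrite -sqrtr_sqr; rewrite -sqrtr0.
apply: (@continuous_cvg _ R R _ _ (fun k => t k ^+ 2) Num.sqrt 0) => //.
exact: sqrt_continuous.
Qed.

Section semi_inner_product.
Context (R : realType) (V : lmodType R) (ip : V -> V -> R).
Hypothesis ipC : forall x y, ip x y = ip y x.
Hypothesis ip_lin : forall a x y z, ip (a *: x + y) z = a * ip x z + ip y z.
Hypothesis ip_ge0 : forall x, 0 <= ip x x.
Local Notation sqn x := (ip x x).

Lemma ip0l x : ip 0 x = 0.
Proof. by have := ip_lin 1 0 0 x; rewrite scaler0 addr0 => ?; lra. Qed.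

Lemma ipDl x y z : ip (x + y) z = ip x z + ip y z.
Proof. by rewrite -[x in LHS]scale1r ip_lin mul1r. Qed.

Lemma ipZl a x y : ip (a *: x) y = a * ip x y.
Proof. by rewrite -[a *: x]addr0 ip_lin ip0l addr0. Qed.

Lemma ipNl x y : ip (- x) y = - ip x y.
Proof. by rewrite -scaleN1r ipZl mulN1r. Qed.

Let ip0r x : ip x 0 = 0. Proof. by rewrite ipC ip0l. Qed.
Let ipDr x y z : ip z (x + y) = ip z x + ip z y.
Proof. by rewrite !(ipC z) ipDl. Qed.
Let ipZr a x y : ip y (a *: x) = a * ip y x.
Proof. by rewrite !(ipC y) ipZl. Qed.
Let ipNr x y : ip y (- x) = - ip y x.
Proof. by rewrite !(ipC y) ipNl. Qed.

Definition ipE := (ipDl, ipDr, ipZl, ipZr, ipNl, ipNr, ip0l, ip0r).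

(** As [sqn x] may vanish for nonzero [x], the usual vector, the component of [y]
    orthogonal to [x], settles only the case [0 < sqn x]; otherwise a large
    multiple of [x] is added to [y]. *)
Lemma ip_cauchy_schwarz x y : ip x y ^+ 2 <= sqn x * sqn y.
Proof.
have : 0 <= sqn (sqn x *: y - ip x y *: x) by exact: ip_ge0.
rewrite !ipE (ipC y x) => h.
have [x0|x0] := eqVneq (sqn x) 0; last first.
  have xp : 0 < sqn x by rewrite lt_def x0 ip_ge0.
  by rewrite -(ler_pM2l xp) -subr_ge0; apply: le_trans h _; lra.
have [->|xy0] := eqVneq (ip x y) 0; first by rewrite x0 mul0r expr0n.
(* With [sqn x = 0] the square is affine in the coefficient of [x]; this
   coefficient makes it equal to -1. *)
have := ip_ge0 (- (sqn y + 1) / (2 * ip x y) *: x + y).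
rewrite !ipE x0 (ipC y x) (_ : _ + _ = -1); first by lra.
by field.
Qed.

Lemma ip_cvg0 (s : nat -> V) y :
  sqn (s k) @[k --> \oo] --> 0 -> ip (s k) y @[k --> \oo] --> 0.
Proof.
move=> s0; apply: cvg_sqr0.
apply: (@squeeze_cvgr _ _ _ _ (cst 0) (fun k => sqn (s k) * sqn y)).
- by apply: nearW => k; rewrite sqr_ge0 ip_cauchy_schwarz.
- exact: cvg_cst.
- by rewrite -(mul0r (sqn y)); apply: cvgMl.
Qed.

Lemma ip_cvg (s : nat -> V) x y :
  sqn (s k - x) @[k --> \oo] --> 0 -> ip (s k) y @[k --> \oo] --> ip x y.
Proof.
move=> sx; rewrite -[X in _ --> X]add0r.
rewrite (_ : (fun _ => _) = fun k => ip (s k - x) y + ip x y); last first.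
  by apply/funext => k; rewrite !ipE subrK.
by apply: cvgD (cvg_cst _); exact: ip_cvg0.
Qed.

Hypothesis ip_complete : forall s : nat -> V,
  (forall e : R, 0 < e -> exists n, forall i j, (n <= i)%N -> (n <= j)%N ->
     sqn (s i - s j) < e) ->
  exists x, sqn (s k - x) @[k --> \oo] --> 0.

(** The representing vector minimizes [sqn x - 2 l x] over [S].  By the
    parallelogram identity minimizing sequences are Cauchy, and the first-order
    condition at the limit is the representation.  As [S] need not be closed, the
    limit is only approximated by elements of [S].  The bound on [l] is written as
    [2 l x <= C + sqn x] because this form passes to limits and holds for
    [l = ip y] by positivity of [sqn (y - x)]; with the latter choice the lemma
    is the orthogonal projection of [y]. *)
Lemma riesz_subspace (S : set V) (l : V -> R) (C : R) :
  S 0 -> (forall a x y, S x -> S y -> S (a *: x + y)) ->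
  (forall a x y, S x -> S y -> l (a *: x + y) = a * l x + l y) ->
  (forall x, S x -> l x *+ 2 <= C + sqn x) ->
  exists x, [/\ exists2 s : nat -> V, forall k, S (s k) &
      sqn (s k - x) @[k --> \oo] --> 0
    & forall y, S y -> ip x y = l y].
Proof.
move=> S0 SD lD lC.
have l0 : l 0 = 0.
  by have := lD 1 0 0 S0 S0; rewrite scaler0 addr0 => ?; lra.
have SZ a x : S x -> S (a *: x) by move=> Sx; rewrite -[_ *: _]addr0; exact: SD.
have lZ a x : S x -> l (a *: x) = a * l x.
  by move=> Sx; rewrite -[_ *: _]addr0 lD// l0 addr0.
pose q x := sqn x - l x *+ 2.
pose Q := [set q x | x in S].
have Qlb : lbound Q (- C) by move=> _ [x /lC xC <-]; rewrite /q; lra.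
have Qinf : has_inf Q by split; [exists (q 0), 0|exists (- C)].
have qge x : S x -> inf Q <= q x.
  by move=> Sx; apply: ge_inf; [exists (- C)|exists x].
have /choice[s sP] (k : nat) : exists x, S x /\ q x < inf Q + k.+1%:R^-1.
  have [|_ [x Sx <-] xk] := @inf_adherent _ Q (k.+1%:R^-1) _ Qinf.
    by rewrite invr_gt0.
  by exists x.
have Ss k : S (s k) := (sP k).1.
have qs k : q (s k) < inf Q + k.+1%:R^-1 := (sP k).2.
have [x sx] : exists x, sqn (s k - x) @[k --> \oo] --> 0.
  apply: ip_complete => e e0.
  have [n ne] : exists n, forall i, (n <= i)%N -> i.+1%:R^-1 < e / 4 :> R.
    have e40 : 0 < e / 4 by rewrite divr_gt0.
    by have [n _ ne] := near_infty_natSinv_lt (PosNum e40); exists n.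
  exists n => i j ni nj.
  have := qge _ (SD 2^-1 _ _ (Ss i) (SZ 2^-1 _ (Ss j))).
  have := qs i; have := qs j; have := ne _ ni; have := ne _ nj.
  rewrite /q (lD _ _ _ (Ss i) (SZ _ _ (Ss j))) (lZ _ _ (Ss j)).
  rewrite !ipE (ipC (s j) (s i)).
  by move: (i.+1%:R^-1) (j.+1%:R^-1) => ? ? ? ? ? ? ?; lra.
exists x; split=> [|y Sy]; first by exists s.
have q_ge0 t : 0 <= t * (ip x y - l y) *+ 2 + t ^+ 2 * sqn y.
  have h : (t * (ip (s k) y - l y) *+ 2 + t ^+ 2 * sqn y) + k.+1%:R^-1
      @[k --> \oo] --> (t * (ip x y - l y) *+ 2 + t ^+ 2 * sqn y) + 0.
    apply: cvgD; last exact: cvg_harmonic.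
    apply: cvgD; last exact: cvg_cst.
    apply: cvgMn; apply: cvgMr; apply: cvgB; last exact: cvg_cst.
    exact: ip_cvg.
  rewrite addr0 in h; rewrite -(cvg_lim _ h)//.
  apply: limr_ge; first by apply/cvg_ex; eexists; exact: h.
  apply: nearW => k; have := qge _ (SD t _ _ Sy (Ss k)); have := qs k.
  by rewrite /q lD// !ipE (ipC y (s k)); move: (k.+1%:R^-1) => ? ? ?; lra.
apply/eqP; rewrite -subr_eq0; apply/negPn/negP => d0.
(* A small step against the sign of the defect; [1 +] covers [sqn y = 0]. *)
have := q_ge0 (- (ip x y - l y) / (1 + sqn y)).
have y1 : 0 < 1 + sqn y by rewrite ltr_pwDl.
move: (ip x y - l y) d0 => D D0.
have -> : - D / (1 + sqn y) * D *+ 2 + (- D / (1 + sqn y)) ^+ 2 * sqn y =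
   - (D ^+ 2 * (2 + sqn y)) / (1 + sqn y) ^+ 2.
  by field; rewrite gt_eqF.
rewrite pmulr_lge0 ?invr_gt0 ?exprn_gt0// oppr_ge0 leNgt => /negP; apply.
by rewrite mulr_gt0 ?exprn_even_gt0//= ltr_pwDl.
Qed.

(** The subspace [S] of the test vectors along which the subsequence converges is
    closed and contains every [u m].  Replacing [y] by its projection on [S] does
    not change [ip (u (phi k)) y], so [S] is the whole space. *)
Lemma bounded_weak_cvg (u : nat -> V) (C : R) : (forall k, sqn (u k) <= C) ->
  exists2 phi, subseq_index phi &
    exists x, forall y, ip (u (phi k)) y @[k --> \oo] --> ip x y.
Proof.
move=> uC.
have C0 : 0 <= C by apply: le_trans (uC 0%N); exact: ip_ge0.
have [|phi hphi phiP] := @bounded_diagonal_subseq R (fun m k => ip (u k) (u m))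
  (fun=> C) _.
  move=> m k /=; rewrite -(@ler_pXn2r _ 2)// ?nnegrE// real_normK ?num_real//.
  by rewrite (le_trans (ip_cauchy_schwarz _ _))// expr2 ler_pM.
exists phi => //.
pose S := [set y | cvgn (fun k => ip (u (phi k)) y)].
pose l y := limn (fun k => ip (u (phi k)) y).
have S0 : S 0.
  rewrite /S/= (_ : (fun _ => _) = cst 0); first exact: is_cvg_cst.
  by apply/funext => k; rewrite ip0r.
have SD a x y : S x -> S y -> S (a *: x + y).
  rewrite /S/= => Sx Sy.
  rewrite (_ : (fun _ => _) = (fun k => a * ip (u (phi k)) x + ip (u (phi k)) y)).
    by apply: is_cvgD => //; exact: is_cvgMr.
  by apply/funext => k; rewrite !ipE.
have lD a x y : S x -> S y -> l (a *: x + y) = a * l x + l y.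
  rewrite /S/l/= => Sx Sy; apply/cvg_lim => //.
  rewrite (_ : (fun _ => _) = (fun k => a * ip (u (phi k)) x + ip (u (phi k)) y)).
    by apply: cvgD => //; exact: cvgMr.
  by apply/funext => k; rewrite !ipE.
have lC x : S x -> l x *+ 2 <= C + sqn x.
  move=> Sx; have h : ip (u (phi k)) x *+ 2 @[k --> \oo] --> l x *+ 2.
    exact: cvgMn.
  rewrite -(cvg_lim _ h)//; apply: limr_le; first by apply/cvg_ex; eexists; exact: h.
  apply: nearW => k; have := uC (phi k); have := ip_ge0 (u (phi k) - x).
  by rewrite !ipE (ipC x) => ? ?; lra.
have S_closed (s : nat -> V) p : (forall k, S (s k)) ->
    sqn (s k - p) @[k --> \oo] --> 0 -> S p.
  move=> Ss sp; apply: cauchy_cvg; apply: cauchy_exP => e e0.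
  have d0 : 0 < (e / 2) ^+ 2 / (C + 1) by rewrite divr_gt0 ?exprn_gt0 ?divr_gt0// ltr_wpDl.
  have [n _ /(_ n (leqnn n))/=] := cvgr_lt 0 sp _ d0.
  rewrite ltr_pdivlMr ?ltr_wpDl// => nd.
  exists (l (s n)); have /cvgrPdist_lt/(_ (e / 2)) := Ss n.
  rewrite divr_gt0// => /(_ isT); apply: filterS => k /= kn.
  rewrite -ball_normE/=.
  have : `|ip (u (phi k)) (s n - p)| < e / 2.
    rewrite -(@ltr_pXn2r _ 2)// ?nnegrE ?(ltW (divr_gt0 e0 _))// real_normK ?num_real//.
    apply: le_lt_trans (ip_cauchy_schwarz _ _) _; apply: le_lt_trans nd.
    rewrite mulrC ler_wpM2l//; have := uC (phi k) => ?; lra.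
  rewrite !ipE => h.
  rewrite (splitr e) (le_lt_trans (ler_distD (ip (u (phi k)) (s n)) _ _))//.
  by rewrite ltrD.
have ST y : S y.
  have [||p [[s Ss sp] pP]] := @riesz_subspace S (ip y) (sqn y) S0 SD.
  - by move=> a x z _ _; rewrite !ipE.
  - by move=> x _; have := ip_ge0 (y - x); rewrite !ipE (ipC x y) => ?; lra.
  have Sp := S_closed s p Ss sp.
  rewrite /S/= (_ : (fun _ => _) = (fun k => ip (u (phi k)) p))//.
  by apply/funext => k; rewrite ipC -pP ?(ipC p)//; exact: phiP.
have [x [_ xP]] := @riesz_subspace S l C S0 SD lD lC.
by exists x => y; rewrite xP//; exact: ST.
Qed.

End semi_inner_product.

(** * Completeness of square-integrable functions *)

Section square_integrable.
Context d (T : measurableType d) (R : realType).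
Variable mu : {measure set T -> \bar R}.
Local Notation Lf := (LfunType mu (lee1n 2)).

Lemma Lnorm2_sqr (f : T -> R) :
  ('N[mu]_2%:E[EFin \o f] ^+ 2 = \int[mu]_x (f x ^+ 2)%:E)%E.
Proof.
have -> : (\int[mu]_x (f x ^+ 2)%:E = 'N[mu]_2%:E[EFin \o f] `^ 2)%E.
  rewrite poweR_Lnorm//; apply: eq_integral => x _ /=.
  by rewrite powR_mulrn// real_normK ?num_real.
have := Lnorm_ge0 mu 2%:E (EFin \o f).
case: ('N[_]__[_])%E => [r|_|//]; last by rewrite poweRyr.
by rewrite lee_fin => r0; rewrite poweR_EFin powR_mulrn// EFin_expe.
Qed.

Lemma Lfun2P (f : T -> R) : measurable_fun setT f ->
  (\int[mu]_x (f x ^+ 2)%:E < +oo)%E -> f \in Lfun mu 2%:E.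
Proof.
move=> mf; rewrite -Lnorm2_sqr => foo; apply/andP; split; rewrite inE//=.
rewrite /finite_norm; move: foo.
have := Lnorm_ge0 mu 2%:E (EFin \o f).
by case: ('N[_]__[_])%E => [r|_|//]; rewrite ?ltry//= expe2 mulyy.
Qed.

Lemma Lfun_measurable (f : Lf) : measurable_fun setT f.
Proof. exact: (@measurable_funPT _ _ _ _ f). Qed.

Definition L2ip (f g : Lf) : R := \int[mu]_x (f x * g x).

Lemma L2ip_integrable (f g : Lf) :
  mu.-integrable setT (EFin \o (fun x => f x * g x)).
Proof. exact/Lfun1_integrable/(Lfun2_mul_Lfun1 (LfunP f) (LfunP g)). Qed.

Lemma EFin_L2ip (f g : Lf) : ((L2ip f g)%:E = \int[mu]_x (f x * g x)%:E)%E.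
Proof. by rewrite fineK//; exact: integrable_fin_num (L2ip_integrable f g). Qed.

Lemma EFin_L2ip_sqr (f : Lf) : ((L2ip f f)%:E = \int[mu]_x (f x ^+ 2)%:E)%E.
Proof. by rewrite EFin_L2ip; under eq_integral do rewrite -expr2. Qed.

Lemma L2ipC f g : L2ip f g = L2ip g f.
Proof. by apply: eq_Rintegral => x _; rewrite mulrC. Qed.

Lemma L2ip_lin a f g h : L2ip (a *: f + g) h = a * L2ip f h + L2ip g h.
Proof.
rewrite /L2ip -RintegralZl//; last exact: L2ip_integrable.
rewrite -RintegralD//; last 2 first.
- have := integrableZl measurableT a (L2ip_integrable f h).
  by apply: eq_integrable => // x _ /=.
- exact: L2ip_integrable.
by apply: eq_Rintegral => x _ /=; rewrite mulrDl mulrA.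
Qed.

Lemma L2ip_ge0 f : 0 <= L2ip f f.
Proof. by apply: Rintegral_ge0 => x _; rewrite -expr2 sqr_ge0. Qed.

(** Along a fast subsequence [g], the series of the
    [4 ^ k * (g k.+1 - g k) ^ 2] has a finite integral, hence a finite sum [h]
    almost everywhere, so that [g k.+1 - g k] is at most [sqrt h / 2 ^ k] in
    absolute value and [g] converges pointwise.  The weights spare the triangle
    inequality for infinite series in L^2.  Fatou's lemma turns pointwise
    convergence into convergence in L^2. *)
Lemma riesz_fischer (s : nat -> Lf) :
  (forall e : R, 0 < e -> exists n, forall i j, (n <= i)%N -> (n <= j)%N ->
     L2ip (s i - s j) (s i - s j) < e) ->
  exists f, L2ip (s k - f) (s k - f) @[k --> \oo] --> 0.
Proof.
move=> cs.
pose del k : R := (4 ^+ k)^-1 * (1 / (2 ^ k.+1)%:R).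
have del_gt0 k : 0 < del k.
  by rewrite mulr_gt0 ?invr_gt0 ?exprn_gt0// divr_gt0// ltr0n expn_gt0.
have /choice[n nP] k := cs _ (del_gt0 k).
(* Partial sums give [n k <= phi m] for all [k <= m], not only for [k = m]. *)
pose phi k := (\sum_(i < k.+1) n i)%N.
have phi_ge k m : (k <= m)%N -> (n k <= phi m)%N.
  by move=> km; rewrite /phi (bigD1 (Ordinal (km : k < m.+1)%N))//= leq_addr.
pose g k : T -> R := s (phi k).
have mg k : measurable_fun [set: T] (g k) by exact: Lfun_measurable.
pose D k x : \bar R := ((4 ^+ k) * (g k.+1 x - g k x) ^+ 2)%:E.
have mD k : measurable_fun [set: T] (D k).
  apply/measurable_EFinP/measurable_funM; first exact: measurable_cst.
  exact/measurable_funX/measurable_funB.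
have D0 k x : (0 <= D k x)%E by rewrite lee_fin mulr_ge0 ?sqr_ge0 ?exprn_ge0.
pose h x := (\sum_(k <oo) D k x)%E.
have h_fin : {ae mu, forall x, setT x -> h x \is a fin_num}.
  apply: integrable_ae => //; apply/integrableP; split.
    by apply: (@ge0_emeasurable_sum _ _ _ setT D predT) => // k _; exact: mD.
  rewrite (_ : (\int[mu]_x `|h x|)%E = \int[mu]_x h x)%E; last first.
    by apply: eq_integral => x _; rewrite gee0_abs// nneseries_ge0.
  rewrite integral_nneseries//.
  apply: (@le_lt_trans _ _ 1%E); last exact: ltry.
  apply: le_trans (epsilon_trick0 predT ler01).
  apply: lee_nneseries => [k _ _|k _]; first exact: integral_ge0.
  rewrite /D; under eq_integral do rewrite EFinM.
  have mdk : measurable_fun [set: T] (fun x => ((g k.+1 x - g k x) ^+ 2)%:E).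
    exact/measurable_EFinP/measurable_funX/measurable_funB.
  rewrite ge0_integralZl ?lee_fin ?exprn_ge0//; last first.
    by move=> x _; rewrite lee_fin sqr_ge0.
  have := nP k _ _ (phi_ge _ _ (leqnSn k)) (phi_ge _ _ (leqnn k)).
  rewrite -lte_fin EFin_L2ip_sqr => /ltW.
  rewrite -(lee_pmul2l (x := (4 ^+ k)%:E))// ?lte_fin ?exprn_gt0//.
  by rewrite -EFinM /del mulVKf// lt0r_neq0// exprn_gt0.
(* The upper limit is measurable without any case distinction, and it is the
   limit wherever there is one. *)
pose F x := fine (limn_esup (fun k => (g k x)%:E)).
have mF : measurable_fun [set: T] F.
  apply: measurableT_comp => //; apply: measurable_fun_limn_esup => k.
  exact/measurable_EFinP.
have gF : {ae mu, forall x, g k x @[k --> \oo] --> F x}.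
  apply: filterS h_fin => x /(_ I) hx.
  have gcvg : cvgn (g ^~ x).
    rewrite (_ : g ^~ x = fun k => g 0%N x + series (telescope (g ^~ x)) k).
      apply: is_cvgD; first exact: is_cvg_cst.
      apply: normed_cvg; apply: (@series_le_cvg _ _
          (geometric (Num.sqrt (fine (h x))) 2^-1)) => [k|k|k|].
      - exact: normr_ge0.
      - by rewrite /= mulr_ge0// ?sqrtr_ge0// exprn_ge0// invr_ge0.
      - rewrite /= -[leLHS]sqrtr_sqr /telescope.
        rewrite -[2^-1 ^+ k]ger0_norm ?exprn_ge0 ?invr_ge0//.
        rewrite -sqrtr_sqr -sqrtrM; last by rewrite fine_ge0// nneseries_ge0.
        rewrite ler_wsqrtr//.
        have -> : (2^-1 ^+ k) ^+ 2 = (4 ^+ k)^-1 :> R.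
          by rewrite exprAC !exprVn -natrX.
        rewrite ler_pdivlMr ?exprn_gt0// -lee_fin fineK// mulrC.
        have := @nneseries_lim_ge _ (D ^~ x) predT 0%N k.+1 (fun n _ _ => D0 n x).
        by apply: le_trans; rewrite big_nat_recr//= leeDr// sume_ge0.
      - by apply: is_cvg_geometric_series; rewrite ger0_norm ?invr_ge0// invf_lt1// ltr1n.
    by apply/funext => k; exact: eq_sum_telescope.
  rewrite /F (cvg_limn_einf_sup (l := (limn (g ^~ x))%:E)) //=.
  by apply: cvg_EFin; [exact: nearW|exact: gcvg].
have sF k i : (n k <= i)%N -> (\int[mu]_x ((s i x - F x) ^+ 2)%:E <= (del k)%:E)%E.
  move=> ki.
  have mq m : measurable_fun [set: T] (fun x => ((s i x - g m x) ^+ 2)%:E).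
    exact/measurable_EFinP/measurable_funX/measurable_funB/mg/Lfun_measurable.
  rewrite (@ge0_ae_eq_integral _ _ _ _ _ _
      (fun x => limn_einf (fun m => ((s i x - g m x) ^+ 2)%:E)))//.
  - apply: le_trans (fatou _ measurableT mq _) _.
      by move=> m x _; rewrite lee_fin sqr_ge0.
    apply: limn_einf_le; exists k => // m /= km.
    by have := nP k i (phi m) ki (phi_ge _ _ km); rewrite -lte_fin EFin_L2ip_sqr => /ltW.
  - apply/measurable_EFinP/measurable_funX.
    exact: measurable_funB (Lfun_measurable (s i)) mF.
  - rewrite /limn_einf; apply: measurableT_comp => //.
    apply: measurable_fun_limn_esup => m.
    by apply: measurableT_comp => //; exact: mq.
  - by move=> x _; rewrite lee_fin sqr_ge0.
  - move=> x _; apply: limn_einf_ge; apply: nearW => m.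
    by rewrite lee_fin sqr_ge0.
  apply: filterS gF => x gFx _; apply/esym.
  apply: (cvg_limn_einf_sup _).1; apply: cvg_EFin; first exact: nearW.
  by apply: cvgM; apply: cvgB => //; exact: cvg_cst.
have dF : (s (n 0%N) \- F) \in Lfun mu 2%:E.
  apply: Lfun2P; first exact/measurable_funB/mF/Lfun_measurable.
  by apply: le_lt_trans (sF 0%N _ (leqnn _)) _; exact: ltry.
(* Square integrability of [F] itself comes from that of [s (n 0) - F]. *)
pose f : Lf := s (n 0%N) - Lfun_Sub (lee1n 2) dF.
have fF x : f x = F x by rewrite /= opprB addrC subrK.
exists f; apply/cvgrPdist_lt => e e0.
have [k ke] : exists k, del k < e.
  have [k _ /(_ k (leqnn k)) /= ke] := near_infty_natSinv_lt (PosNum e0).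
  exists k; apply: le_lt_trans ke.
  apply: (@le_trans _ _ (2 ^ k.+1)%:R^-1).
    rewrite /del mul1r ler_piMl ?invr_ge0//.
    by rewrite invf_le1 ?exprn_gt0// exprn_ege1// ler1n.
  by rewrite lef_pV2 ?posrE// ?ler_nat ?ltr0n ?expn_gt0// ltnW// ltn_expl.
exists (n k) => // i /= ki.
rewrite sub0r normrN ger0_norm ?L2ip_ge0//; apply: le_lt_trans ke.
rewrite -lee_fin EFin_L2ip_sqr; apply: le_trans (sF _ _ ki).
by rewrite le_eqVlt; apply/orP/or_introl/eqP/eq_integral => x _; rewrite -fF.
Qed.
End square_integrable.

(** * The Hilbert structure of L^2 *)

Section L2_hilbert.
Context d (T : measurableType d) (R : realType).
Variable mu : {measure set T -> \bar R}.
Local Notation Lf := (LfunType mu (lee1n 2)).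
Local Notation L2mu := (LspaceType2 mu).

Lemma L2ip_ae_eq (f g h : Lf) : f = g %[ae mu] -> L2ip f h = L2ip g h.
Proof.
move=> fg; apply: EFin_inj; rewrite !EFin_L2ip; apply: ae_eq_integral => //.
- exact: measurable_int (L2ip_integrable f h).
- exact: measurable_int (L2ip_integrable g h).
by apply: filterS fg => x /= + _ => ->.
Qed.

Lemma L2_rep_subproof (u : L2mu) : (u : T -> R) \in Lfun mu 2%:E.
Proof.
apply/andP; split; rewrite inE/=; last exact: Lebesgue_finite.
exact: (@measurable_funPT _ _ _ _ (repr (u : {mfun_ mu, T >-> measurableTypeR R}))).
Qed.

Definition L2_rep (u : L2mu) : Lf := Lfun_Sub (lee1n 2) (L2_rep_subproof u).

(** Elements of L^2 act through representatives, so facts about functions transfer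
    once every square-integrable function represents some element. *)
Lemma L2_rep_surj (f : Lf) : exists u : L2mu, L2_rep u = f %[ae mu].
Proof.
have mf : (f : T -> measurableTypeR R) \in mfun.
  by apply/mem_set; exact: Lfun_measurable.
pose q : {mfun_ mu, T >-> measurableTypeR R} :=
  (\pi_({mfun_ mu, T >-> measurableTypeR R}) (mfun_Sub mf))%qT.
have qf : (q : T -> R) = f %[ae mu].
  have /eqquotP/asboolP : (repr q = mfun_Sub mf %[mod {mfun_ mu, T >-> measurableTypeR R}])%qT.
    by rewrite reprK.
  by [].
have fq : finite_norm mu 2%:E q.
  have mq : measurable_fun [set: T] (q : T -> R).
    exact: (@measurable_funPT _ _ _ _ (repr q)).
  suff /andP[_] : (q : T -> R) \in Lfun mu 2%:E by rewrite inE.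
  apply: Lfun2P => //.
  rewrite (@ge0_ae_eq_integral _ _ _ _ _ _ (fun x => (f x ^+ 2)%:E))//.
  - by rewrite -EFin_L2ip_sqr ltry.
  - exact/measurable_EFinP/measurable_funX.
  - exact/measurable_EFinP/measurable_funX/Lfun_measurable.
  - by move=> x _; rewrite lee_fin sqr_ge0.
  - by move=> x _; rewrite lee_fin sqr_ge0.
  by apply: filterS qf => x /= + _ => ->.
by exists (LebesgueSpace.Pack (LebesgueSpace.Class
  (isFinLebesgue.Build _ _ _ _ _ (lee1n 2) _ fq))).
Qed.

Definition sqdist (u v : L2mu) : R :=
  L2ip (L2_rep u - L2_rep v) (L2_rep u - L2_rep v).

Lemma sqdist_ge0 u v : 0 <= sqdist u v. Proof. exact: L2ip_ge0. Qed.

Lemma L2dist_sqr u v : (L2dist u v ^+ 2 = (sqdist u v)%:E)%E.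
Proof. by rewrite /L2dist Lnorm2_sqr EFin_L2ip_sqr. Qed.

Lemma weak_cvgP (u_ : nat -> L2mu) u : weak_cvg u_ u <->
  forall f : Lf, L2ip (L2_rep (u_ k)) f @[k --> \oo] --> L2ip (L2_rep u) f.
Proof.
have pE u' v : L2prod u' v = (L2ip (L2_rep u') (L2_rep v))%:E by rewrite EFin_L2ip.
split=> [h f|h v].
  have [v vf] := L2_rep_surj f.
  have E g : L2ip g f = L2ip g (L2_rep v) by rewrite !(L2ipC g); apply/esym/L2ip_ae_eq.
  have := h v; rewrite pE E; under eq_fun do rewrite pE.
  by move/fine_cvg => /=; under [X in _ -> X]eq_cvg do rewrite E.
rewrite pE; under eq_fun do rewrite pE.
by apply: cvg_EFin; [exact: nearW|exact: h].
Qed.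

Local Notation ipE := (ipE (@L2ipC _ _ _ mu) (@L2ip_lin _ _ _ mu)).

(** The workhorse: expanding squares, the difference is affine in [u_ k].  Since
    [sqdist (u_ k) u] is nonnegative this contains weak lower semicontinuity of the
    distance, and it shows that weak convergence is strong as soon as the distances
    to one point [c] converge to the right value. *)
Lemma weak_cvg_sqdist (u_ : nat -> L2mu) u c : weak_cvg u_ u ->
  sqdist (u_ k) c - sqdist (u_ k) u @[k --> \oo] --> sqdist u c.
Proof.
move=> /weak_cvgP/(_ (L2_rep u - L2_rep c)) h.
have -> : (fun k => sqdist (u_ k) c - sqdist (u_ k) u) =
  (fun k => L2ip (L2_rep (u_ k)) (L2_rep u - L2_rep c) *+ 2 +
     (L2ip (L2_rep c) (L2_rep c) - L2ip (L2_rep u) (L2_rep u))).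
  apply/funext => k; rewrite /sqdist !ipE.
  by rewrite (L2ipC (L2_rep c) (L2_rep (u_ k))) (L2ipC (L2_rep u) (L2_rep (u_ k))); ring.
have -> : sqdist u c = L2ip (L2_rep u) (L2_rep u - L2_rep c) *+ 2 +
     (L2ip (L2_rep c) (L2_rep c) - L2ip (L2_rep u) (L2_rep u)).
  by rewrite /sqdist !ipE (L2ipC (L2_rep c) (L2_rep u)); ring.
by apply: cvgD (cvg_cst _); apply: cvgMn.
Qed.

Lemma strong_cvg_sqdist (u_ : nat -> L2mu) u : strong_cvg u_ u ->
  sqdist (u_ k) u @[k --> \oo] --> 0.
Proof.
move=> h; have : (L2dist (u_ k) u * L2dist (u_ k) u)%E @[k --> \oo] --> (0 * 0)%E.
  by apply: cvgeM.
rewrite mul0e; under eq_fun do rewrite -expe2 L2dist_sqr.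
by move/fine_cvg.
Qed.

Lemma sqdist_cvg_weak (u_ : nat -> L2mu) u :
  sqdist (u_ k) u @[k --> \oo] --> 0 -> weak_cvg u_ u.
Proof.
move=> h; apply/weak_cvgP => f.
exact: (ip_cvg (@L2ipC _ _ _ mu) (@L2ip_lin _ _ _ mu) (@L2ip_ge0 _ _ _ mu)).
Qed.

Lemma weak_cvg_subseq (u_ : nat -> L2mu) u phi : subseq_index phi ->
  weak_cvg u_ u -> weak_cvg (u_ \o phi) u.
Proof.
move=> hphi uu v; apply: (cvg_comp phi) (uu v).
exact: subseq_index_cvg.
Qed.

Lemma L2_weak_compact (u_ : nat -> L2mu) c C :
  (\forall k \near \oo, sqdist (u_ k) c <= C) ->
  exists2 phi, subseq_index phi & exists u, weak_cvg (u_ \o phi) u.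
Proof.
move=> [n _ uC].
have [k|phi hphi [x xP]] := bounded_weak_cvg (@L2ipC _ _ _ mu) (@L2ip_lin _ _ _ mu)
  (@L2ip_ge0 _ _ _ mu) (@riesz_fischer _ _ _ mu)
  (u := fun k => L2_rep (u_ (k + n)%N) - L2_rep c) (C := C).
  by apply: uC => /=; rewrite leq_addl.
exists (fun k => (phi k + n)%N) => [i j ij|]; first by rewrite ltn_add2r hphi.
have [u ux] := L2_rep_surj (x + L2_rep c).
exists u; apply/weak_cvgP => f; rewrite (L2ip_ae_eq _ ux) !ipE.
have -> : (fun k => L2ip (L2_rep ((u_ \o (fun k => (phi k + n)%N)) k)) f) =
    fun k => L2ip (L2_rep (u_ (phi k + n)%N) - L2_rep c) f + L2ip (L2_rep c) f.
  by apply/funext => k; rewrite !ipE subrK.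
by apply: cvgD (cvg_cst _).
Qed.

End L2_hilbert.

(** * Gamma-limits, Mosco-limits and minimizers *)

Section variational.
Context d (T : measurableType d) (R : realType).
Variable mu : {measure set T -> \bar R}.
Local Notation L2mu := (LspaceType2 mu).
Implicit Types u v w c : L2mu.

Lemma weak_cvg_cst u : weak_cvg (fun=> u) u.
Proof. by move=> v; exact: cvg_cst. Qed.

Lemma sqdist_weak_lsc c : weak_lsc (fun u => (sqdist u c)%:E).
Proof.
move=> u_ u uu.
have uE : limn_einf (fun k => (sqdist (u_ k) c - sqdist (u_ k) u)%:E) =
    (sqdist u c)%:E.
  apply: (cvg_limn_einf_sup _).1; apply: cvg_EFin; first exact: nearW.
  exact: weak_cvg_sqdist.
rewrite -[leLHS]uE; apply: limn_einf_mono; apply: nearW => k.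
by rewrite lee_fin gerBl sqdist_ge0.
Qed.

Lemma weak_lscD (F G : L2mu -> \bar R) : (forall u, 0 <= F u)%E ->
  (forall u, 0 <= G u)%E -> weak_lsc F -> weak_lsc G ->
  weak_lsc (fun u => F u + G u)%E.
Proof.
move=> F0 G0 hF hG u_ u uu; apply: (le_trans (leeD (hF _ _ uu) (hG _ _ uu))).
by apply: limn_einfD => k /=; [exact: F0|exact: G0].
Qed.

(** The direct method; coercivity comes from the distance alone. *)
Lemma argmin_sqdistD (G : L2mu -> \bar R) c : (forall u, 0 <= G u)%E ->
  weak_lsc G -> [set u | (G u < +oo)%E] !=set0 ->
  argmin setT (fun u => (sqdist u c)%:E + G u)%E !=set0.
Proof.
move=> G0 Glsc [v Gv]; pose J u := ((sqdist u c)%:E + G u)%E.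
have Jlsc : weak_lsc J.
  by apply: weak_lscD => //; [move=> u; rewrite lee_fin sqdist_ge0|exact: sqdist_weak_lsc].
have [|s sJ sm] := @ereal_inf_seq _ (range J).
  by apply/set0P; exists (J v), v.
have {sJ}/choice[u_ u_s] k : exists u, J u = s k by have [u] := sJ k; exists u.
have mJ u : (ereal_inf (range J) <= J u)%E by apply: ereal_inf_lbound; exists u.
have mfin : ereal_inf (range J) \is a fin_num.
  rewrite ge0_fin_numE.
    by apply: le_lt_trans (mJ v) _; rewrite lte_add_pinfty// ltry.
  by apply: le_ereal_inf_tmp => _ [u _ <-]; rewrite adde_ge0// lee_fin sqdist_ge0.
move: mJ sm; rewrite -(fineK mfin); move: (fine _) => m mJ sm.
have [|phi hphi [u uu]] := @L2_weak_compact _ _ _ mu u_ c (m + 1).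
  have /fine_cvgP[sfin /cvgr_le/(_ (m + 1))] := sm.
  rewrite ltrDl ltr01 => /(_ isT); apply: filterS2 sfin => k /fineK sk.
  rewrite -2!lee_fin sk -u_s; apply: le_trans; by rewrite leeDl.
exists u; split; [exact: I|move=> v' _; apply: le_trans (mJ v')].
apply: le_trans (Jlsc _ _ uu) _.
rewrite (cvg_limn_einf_sup (l := m%:E) _).1//.
rewrite (_ : J \o _ = s \o phi); last by apply/funext => k /=.
exact: (cvg_comp phi s (subseq_index_cvg hphi)).
Qed.

Lemma gamma_lim_cst (F G : L2mu -> \bar R) : weak_lsc F ->
  gamma_lim (fun=> F) G -> G = F.
Proof.
move=> Flsc [Ginf Gsup]; apply/funext => u; apply/eqP; rewrite eq_le.
apply/andP; split.
  apply: le_trans (Ginf _ _ (@weak_cvg_cst u)) _.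
  by apply: limn_einf_le; exact: nearW.
have [u_ uu uG] := Gsup u; apply: le_trans (Flsc _ _ uu) _.
by apply: le_trans uG; exact: limn_einf_sup.
Qed.

Lemma gamma_lim_argmin (F_ : nat -> L2mu -> \bar R) F (w_ : nat -> L2mu) w :
  gamma_lim F_ F -> (forall k, argmin setT (F_ k) (w_ k)) -> weak_cvg w_ w ->
  argmin setT F w.
Proof.
move=> [Finf Fsup] wF ww; split=> // v _.
apply: le_trans (Finf _ _ ww) _; have [v_ _ vF] := Fsup v.
by apply: le_trans vF; apply: limn_einf_le_esup; apply: nearW => k; apply: (wF k).2.
Qed.

(** A recovery sequence of a point of finite energy bounds the minimal energies,
    hence the distances of the minimizers to [c]. *)
Lemma gamma_lim_argmin_sqdist_bounded (G_ : nat -> L2mu -> \bar R) c F (w_ : nat -> L2mu) v :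
  (forall k u, 0 <= G_ k u)%E ->
  gamma_lim (fun k u => (sqdist u c)%:E + G_ k u)%E F -> (F v < +oo)%E ->
  (forall k, argmin setT (fun u => (sqdist u c)%:E + G_ k u)%E (w_ k)) ->
  exists C, \forall k \near \oo, sqdist (w_ k) c <= C.
Proof.
move=> G0 [_ Fsup] Fv wF; have [v_ _ vF] := Fsup v.
have [C FC] : exists C : R, (F v < C%:E)%E.
  case: (F v) Fv => [r _|//|_]; last by exists 0; rewrite ltNyr.
  by exists (r + 1); rewrite lte_fin ltrDl.
exists C; have := limn_esup_lt (le_lt_trans vF FC); apply: filterS => k.
move=> /(le_lt_trans ((wF k).2 (v_ k) I))/ltW; rewrite -lee_fin.
by apply: le_trans; rewrite leeDl.
Qed.

(** Compare [w_ k] with a strong recovery sequence [v_] of [w] for [G]: the upper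
    limit of [sqdist (w_ k) c + G_ k (w_ k)] is at most [sqdist w c + G w], while
    the lower limit of [G_ k (w_ k)] is at least [G w].  So [sqdist (w_ k) c]
    cannot exceed [sqdist w c] in the limit, which by [weak_cvg_sqdist] forces
    [sqdist (w_ k) w] to vanish.  Subtracting [G w] requires it to be finite,
    which follows from the Gamma-limit at [w]. *)
Lemma mosco_argmin_strong (G_ : nat -> L2mu -> \bar R) c F G (w_ : nat -> L2mu) w :
  (forall k u, 0 <= G_ k u)%E ->
  gamma_lim (fun k u => (sqdist u c)%:E + G_ k u)%E F -> mosco_lim G_ G ->
  (forall k, argmin setT (fun u => (sqdist u c)%:E + G_ k u)%E (w_ k)) ->
  weak_cvg w_ w -> (F w < +oo)%E ->
  sqdist (w_ k) w @[k --> \oo] --> 0.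
Proof.
(* How the estimates below, valid for large [k], combine with the minimality of
   [w_ k]. *)
have closing (x y z t a b r e : R) : x - e / 4 < z - t -> y < x + e / 4 ->
    b < r + e / 4 -> r - e / 4 < a -> z + a <= y + b -> t < e.
  by move=> *; lra.
move=> G0 [_ Fsup] [[Ginf _] Gsup] wF ww Fw.
have Gw_lt : (G w < +oo)%E.
  have [z_ zw zF] := Fsup w; apply: le_lt_trans Fw; apply: le_trans zF.
  apply: le_trans (Ginf _ _ zw) _; apply: limn_einf_le_esup; apply: nearW => k.
  by rewrite leeDr// lee_fin sqdist_ge0.
have [v_ vw vG] := Gsup w.
have Gw_ge : (0 <= G w)%E.
  apply: le_trans vG; apply: le_trans (limn_einf_sup _).
  by apply: limn_einf_ge; exact: nearW.
have Ginf_w := Ginf _ _ ww.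
have vc : sqdist (v_ k) c @[k --> \oo] --> sqdist w c.
  have vw0 := strong_cvg_sqdist vw.
  rewrite -[X in _ --> X]addr0 (_ : (fun _ => _) = fun k =>
      (sqdist (v_ k) c - sqdist (v_ k) w) + sqdist (v_ k) w).
    by apply: (cvgD _ vw0); apply: weak_cvg_sqdist; exact: sqdist_cvg_weak.
  by apply/funext => k; rewrite subrK.
have wc := weak_cvg_sqdist (c := c) ww.
move: (G w) Gw_lt Gw_ge Ginf_w vG => [r|//|//] _ _ Ginf_w vG.
apply/cvgrPdist_lt => e e0; have e4 : 0 < e / 4 by rewrite divr_gt0.
have n1 : \forall k \near \oo, ((r - e / 4)%:E < G_ k (w_ k))%E.
  by apply: limn_einf_gt; apply: lt_le_trans Ginf_w; rewrite lte_fin ltrBlDr ltrDl.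
have n2 : \forall k \near \oo, (G_ k (v_ k) < (r + e / 4)%:E)%E.
  by apply: limn_esup_lt; apply: le_lt_trans vG _; rewrite lte_fin ltrDl.
have n3 : \forall k \near \oo, sqdist (v_ k) c < sqdist w c + e / 4.
  by apply: (cvgr_lt _ vc); rewrite ltrDl.
have n4 : \forall k \near \oo, sqdist w c - e / 4 < sqdist (w_ k) c - sqdist (w_ k) w.
  by apply: (cvgr_gt _ wc); rewrite ltrBlDr ltrDl.
near=> k.
rewrite sub0r normrN ger0_norm ?sqdist_ge0//.
have := (wF k).2 (v_ k) I.
have : ((r - e / 4)%:E < G_ k (w_ k))%E by near: k.
have : (G_ k (v_ k) < (r + e / 4)%:E)%E by near: k.
have : sqdist (v_ k) c < sqdist w c + e / 4 by near: k.
have : sqdist w c - e / 4 < sqdist (w_ k) c - sqdist (w_ k) w by near: k.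
have := G0 k (v_ k); have := G0 k (w_ k).
move: (sqdist (w_ k) w) (sqdist (w_ k) c) (sqdist (v_ k) c) (sqdist w c).
move=> t z y x; case: (G_ k (w_ k)) => [a|//|//]; case: (G_ k (v_ k)) => [b|//|//] //.
rewrite -!EFinD !lte_fin !lee_fin => _ _ h1 h2 h3 h4.
exact (closing _ _ _ _ _ _ _ _ h1 h2 h3 h4).
Unshelve. all: by end_near. Qed.

(** One extraction per component, by induction on a list of components. *)
Lemma L2_weak_compact_family N (u_ : nat -> 'I_N -> L2mu) (c : 'I_N -> L2mu) :
  (forall j, exists C, \forall k \near \oo, sqdist (u_ k j) (c j) <= C) ->
  exists2 phi, subseq_index phi &
    exists w : 'I_N -> L2mu, forall j, weak_cvg (fun k => u_ (phi k) j) (w j).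
Proof.
move=> uC.
suff [phi hphi phiP] : exists2 phi, subseq_index phi & forall j, j \in enum 'I_N ->
    exists w, weak_cvg (fun k => u_ (phi k) j) w.
  have /choice[w wP] j : exists w, weak_cvg (fun k => u_ (phi k) j) w.
    by apply: phiP; rewrite mem_enum.
  by exists phi => //; exists w.
elim: (enum _) => [|j s [phi hphi phiP]]; first by exists id.
have [C uCj] := uC j.
have [|psi hpsi [w ww]] := @L2_weak_compact _ _ _ mu (fun k => u_ (phi k) j) (c j) C.
  case: uCj => n _ uCn; exists n; [exact: I|move=> k nk].
  apply: uCn; exact: leq_trans nk (subseq_index_ge hphi k).
exists (phi \o psi) => [|i]; first exact: subseq_index_comp.
rewrite inE => /predU1P[->|/phiP[v /(weak_cvg_subseq hpsi)]]; first by exists w.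
by exists v.
Qed.

End variational.

(** * The bilevel problem and its extension *)

Section bilevel.
Context d (T : measurableType d) (R : realType).
Variable mu : {measure set T -> \bar R}.
Local Notation L2mu := (LspaceType2 mu).
Context (N : nat) (uc ueta : 'I_N -> L2mu).

Lemma denoisingE (Reg : L2mu -> \bar R) j :
  denoising ueta Reg j = fun u => ((sqdist u (ueta j))%:E + Reg u)%E.
Proof. by apply/funext => u; rewrite /denoising L2dist_sqr. Qed.

Lemma vL2dist2E (w : 'I_N -> L2mu) :
  vL2dist2 w uc = (\sum_(j < N) sqdist (w j) (uc j))%:E.
Proof. by rewrite /vL2dist2 -sumEFin; apply: eq_bigr => j _; exact: L2dist_sqr. Qed.

Lemma upper_level_le (J : 'I_N -> L2mu -> \bar R) w :
  minimizers J w -> (upper_level uc J <= vL2dist2 w uc)%E.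
Proof. by move=> Jw; apply: ereal_inf_lbound; exists w. Qed.

Context (X : topologicalType) (X1 : first_countable X) (Lam : set X).
Context (Reg : X -> L2mu -> \bar R)
    (Reg_ge0 : forall l, Lam l -> forall u, (0 <= Reg l u)%E)
    (Reg_lsc : forall l, Lam l -> weak_lsc (Reg l))
    (Reg_proper : forall l, Lam l -> [set v | (Reg l v < +oo)%E] !=set0)
    (Jbar : X -> 'I_N -> L2mu -> \bar R)
    (JbarE : forall l, closure Lam l -> forall j,
      lim_along (@gamma_lim _ _ _ _) Lam
        (fun l' => denoising ueta (Reg l') j) l (Jbar l j))
    (Rbar : X -> L2mu -> \bar R)
    (RbarE : forall l, closure Lam l ->
      lim_along (@mosco_lim _ _ _ _) Lam Reg l (Rbar l))
    (Kbar1 : forall l, (closure Lam `\` Lam) l ->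
      exists w, minimizers (Jbar l) = [set w]).
Local Notation J l := (denoising ueta (Reg l)).
Local Notation I l := (upper_level uc (J l)).
Local Notation Ibar l := (upper_level uc (Jbar l)).

Lemma minimizers_neq0 l : Lam l -> minimizers (J l) !=set0.
Proof.
move=> Ll; have /choice[w wP] j : exists u, argmin setT (J l j) u.
  by rewrite denoisingE; apply: argmin_sqdistD;
    [exact: Reg_ge0|exact: Reg_lsc|exact: Reg_proper].
by exists w.
Qed.

(** Apply the Gamma-limit along a constant sequence. *)
Lemma extensionE l : Lam l -> Jbar l = J l.
Proof.
move=> Ll; apply/funext => j; apply: gamma_lim_cst; last first.
  exact: (@JbarE l (subset_closure Ll) j (fun=> l) (fun=> Ll) (cvg_cst _)).
rewrite denoisingE; apply: weak_lscD; [|exact: Reg_ge0| |exact: Reg_lsc].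
  by move=> u; rewrite lee_fin sqdist_ge0.
exact: sqdist_weak_lsc.
Qed.

Lemma minimizers_weak_closed (l : nat -> X) l0 w_ w :
  closure Lam l0 -> (forall k, Lam (l k)) -> l @ \oo --> l0 ->
  (forall k, minimizers (J (l k)) (w_ k)) ->
  (forall j, weak_cvg (fun k => w_ k j) (w j)) -> minimizers (Jbar l0) w.
Proof.
move=> cl0 Ll ll0 wJ ww j.
by apply: gamma_lim_argmin (@JbarE l0 cl0 j l Ll ll0) _ (ww j) => k; exact: wJ.
Qed.

(** Stated with a strict bound on [I (l k)], so that elements of the solution sets
    below the bound exist without attainment of the infimum. *)
Lemma extension_lsc (l : nat -> X) l0 (M : R) :
  closure Lam l0 -> (forall k, Lam (l k)) -> l @ \oo --> l0 ->
  (\forall k \near \oo, (I (l k) < M%:E)%E) -> (Ibar l0 <= M%:E)%E.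
Proof.
move=> cl0 Ll ll0 [n _ IM].
have /choice[w_ w_P] k : exists w, minimizers (J (l (k + n)%N)) w /\
    (vL2dist2 w uc < M%:E)%E.
  have /= /ereal_inf_lt[_ [w Jw <-] wM] := IM (k + n)%N (leq_addl _ _).
  by exists w.
have [|phi hphi [w ww]] := L2_weak_compact_family (u_ := w_) (c := uc).
  move=> j; exists M; apply: nearW => k.
  rewrite -lee_fin; apply: le_trans (ltW (w_P k).2).
  by rewrite vL2dist2E lee_fin (bigD1 j)//= lerDl sumr_ge0// => i _; exact: sqdist_ge0.
have Jw : minimizers (Jbar l0) w.
  apply: (@minimizers_weak_closed (fun k => l (phi k + n)%N) l0 (w_ \o phi)) => //.
    apply: (cvg_comp (fun k => (phi k + n)%N) l _ ll0).
    by apply: subseq_index_cvg => i j ij; rewrite ltn_add2r hphi.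
  by move=> k; exact: (w_P (phi k)).1.
apply: le_trans (upper_level_le Jw) _; rewrite vL2dist2E lee_fin.
(* Dropping the second distances only increases the sums, and with them the sums
   converge. *)
have h : (\sum_(j < N) (sqdist (w_ (phi k) j) (uc j) - sqdist (w_ (phi k) j) (w j)))
    @[k --> \oo] --> \sum_(j < N) sqdist (w j) (uc j).
  apply: cvg_big => [|j _]; first exact: add_continuous.
  by apply: weak_cvg_sqdist; exact: ww.
rewrite -(cvg_lim _ h)//; apply: limr_le; first by apply/cvg_ex; eexists; exact: h.
apply: nearW => k; have := ltW (w_P (phi k)).2; rewrite vL2dist2E lee_fin.
apply: le_trans; apply: ler_sum => j _.
by rewrite gerBl sqdist_ge0.
Qed.

(** The only place where the Mosco-limit and the uniqueness of the limiting
    solution enter: minimizers for parameters in [Lam] tending to [l0] are shown to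
    converge strongly to that solution. *)
Lemma inf_le_extension l0 : closure Lam l0 ->
  (ereal_inf [set I l | l in Lam] <= Ibar l0)%E.
Proof.
move=> cl0; have [Ll0|nLl0] := pselect (Lam l0).
  by rewrite extensionE//; apply: ereal_inf_lbound; exists l0.
have [l Ll ll0] := closure_seq X1 cl0.
have [w Kw] := Kbar1 (conj cl0 nLl0).
have Jw : minimizers (Jbar l0) w by rewrite Kw.
have -> : Ibar l0 = vL2dist2 w uc by rewrite /upper_level Kw image_set1 ereal_inf1.
have Ile k v : minimizers (J (l k)) v ->
    (ereal_inf [set I l | l in Lam] <= vL2dist2 v uc)%E.
  move=> /upper_level_le; apply: le_trans.
  by apply: ereal_inf_lbound; exists (l k).
have /choice[w_ wJ] k := minimizers_neq0 (Ll k).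
(* Without a point of finite limiting energy there is no bound on the minimizers.
   But if some [Jbar l0 j] is identically [+oo], then every [u] is one of its
   minimizers, and uniqueness leaves a single element in the whole space. *)
have [[j Joo]|Jfin] := pselect (exists j, forall u, Jbar l0 j u = +oo%E).
  suff L2_1 u : u = w j.
    have -> : w = w_ 0%N by apply/funext => i; rewrite [LHS]L2_1 [RHS]L2_1.
    exact: (Ile 0%N _ (wJ 0%N)).
  pose w' i := if i == j then u else w i.
  have : minimizers (Jbar l0) w'.
    move=> i; rewrite /w'; case: eqP => [->|_]; last exact: Jw.
    by split=> // v _; rewrite !Joo.
  by rewrite Kw => /(congr1 (@^~ j)); rewrite /w' eqxx.
have Gl j : gamma_lim (fun k u => (sqdist u (ueta j))%:E + Reg (l k) u)%E (Jbar l0 j).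
  have := @JbarE l0 cl0 j l Ll ll0.
  by congr gamma_lim; apply/funext => k /=; rewrite denoisingE.
have wF j k : argmin setT (fun u => (sqdist u (ueta j))%:E + Reg (l k) u)%E (w_ k j).
  by have := wJ k j; rewrite denoisingE.
have Jv j : exists v, (Jbar l0 j v < +oo)%E.
  apply: contrapT => /forallNP h; apply: Jfin; exists j => u.
  by apply/eqP; rewrite -leye_eq leNgt; exact/negP.
have [|phi hphi [w' ww']] := L2_weak_compact_family (u_ := w_) (c := ueta).
  move=> j; have [v vF] := Jv j.
  by apply: gamma_lim_argmin_sqdist_bounded (Gl j) vF (wF j) => k u; exact: Reg_ge0.
have Lp k : Lam (l (phi k)) by exact: Ll.
have lp : (l \o phi) @ \oo --> l0.
  by apply: cvg_comp ll0; exact: subseq_index_cvg.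
have w'E : w' = w.
  have := minimizers_weak_closed cl0 Lp lp (fun k => wJ (phi k)) ww'.
  by rewrite Kw.
rewrite w'E in ww'.
have wcvg j : sqdist (w_ (phi k) j) (w j) @[k --> \oo] --> 0.
  have [v vF] := Jv j.
  apply: (@mosco_argmin_strong _ _ _ _ (Reg \o (l \o phi)) (ueta j) (Jbar l0 j) (Rbar l0)).
  - by move=> k u; exact: (Reg_ge0 (Lp k)).
  - have := @JbarE l0 cl0 j _ Lp lp.
    by congr gamma_lim; apply/funext => k /=; rewrite denoisingE.
  - exact: (@RbarE l0 cl0 (l \o phi) Lp lp).
  - by move=> k; exact: wF.
  - exact: ww'.
  - by apply: le_lt_trans vF; exact: (Jw j).2.
have h : (\sum_(j < N) sqdist (w_ (phi k) j) (uc j))%:E @[k --> \oo] -->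
    (\sum_(j < N) sqdist (w j) (uc j))%:E.
  apply: cvg_EFin; first exact: nearW.
  apply: cvg_big => [|j _]; first exact: add_continuous.
  rewrite -[X in _ --> X]addr0.
  rewrite (_ : (fun _ => _) = fun k => (sqdist (w_ (phi k) j) (uc j) -
      sqdist (w_ (phi k) j) (w j)) + sqdist (w_ (phi k) j) (w j)).
    by apply: (cvgD _ (wcvg j)); apply: weak_cvg_sqdist; exact: ww'.
  by apply/funext => k; rewrite subrK.
rewrite vL2dist2E -(cvg_lim _ h)//.
apply: lime_ge; first by apply/cvg_ex; eexists; exact: h.
by apply: nearW => k; rewrite -vL2dist2E; apply: Ile; exact: wJ.
Qed.

Lemma minimizing_sequence_limit (l : nat -> X) l0 :
  closure Lam l0 -> (forall k, Lam (l k)) -> l @ \oo --> l0 ->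
  I (l k) @[k --> \oo] --> ereal_inf [set I l | l in Lam] ->
  Ibar l0 = ereal_inf [set I l | l in Lam].
Proof.
move=> cl0 Ll ll0 Il; apply/eqP; rewrite eq_le inf_le_extension// andbT.
have : (0 <= ereal_inf [set I l | l in Lam])%E.
  apply: le_ereal_inf_tmp => _ [x _ <-]; apply: le_ereal_inf_tmp => _ [w _ <-].
  by rewrite vL2dist2E lee_fin sumr_ge0// => j _; exact: sqdist_ge0.
move: Il; case: (ereal_inf _) => [m Il _|_ _|//]; last exact: leey.
apply/lee_addgt0Pr => e e0; apply: (extension_lsc cl0 Ll ll0).
have /fine_cvgP[Ifin /cvgr_lt/(_ (m + e))] := Il.
rewrite ltrDl => /(_ e0); apply: filterS2 Ifin => k /fineK Ik.
by rewrite -lte_fin /= Ik.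
Qed.

Theorem bilevel_extension (Lam0 : Lam !=set0) (cLam : compact (closure Lam)) :
  [/\ exists2 l, argmin (closure Lam) (fun l => Ibar l) l &
        Ibar l = ereal_inf [set I l' | l' in Lam],
      forall l : nat -> X, (forall k, Lam (l k)) ->
        I (l k) @[k --> \oo] --> ereal_inf [set I l' | l' in Lam] ->
        exists2 phi : nat -> nat, {homo phi : i j / (i < j)%N} &
          exists2 lim_l, argmin (closure Lam) (fun l => Ibar l) lim_l &
            l (phi k) @[k --> \oo] --> lim_l
    & forall l, Lam l -> argmin (closure Lam) (fun l => Ibar l) l ->
        argmin Lam (fun l => I l) l].
Proof.
have min_cvg (l : nat -> X) : (forall k, Lam (l k)) ->
    I (l k) @[k --> \oo] --> ereal_inf [set I l' | l' in Lam] ->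
    exists2 phi, subseq_index phi & exists2 l0, argmin (closure Lam) (fun l => Ibar l) l0
      /\ Ibar l0 = ereal_inf [set I l' | l' in Lam]
      & l (phi k) @[k --> \oo] --> l0.
  move=> Ll Il.
  have [phi hphi [l0 cl0 ll0]] := compact_subseq X1 cLam (fun k => subset_closure (Ll k)).
  have E : Ibar l0 = ereal_inf [set I l' | l' in Lam].
    apply: (minimizing_sequence_limit cl0 (fun k => Ll (phi k)) ll0).
    exact: (cvg_comp phi (fun k => I (l k)) (subseq_index_cvg hphi)).
  exists phi => //; exists l0 => //; split=> //; split=> // x cx.
  by rewrite E; exact: inf_le_extension.
split.
- have [|s sI sm] := @ereal_inf_seq _ [set I l' | l' in Lam].
    by have [x Lx] := Lam0; apply/set0P; exists (I x), x.
  have /choice[l lP] k : exists l, Lam l /\ I l = s k.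
    by have [l Ll ls] := sI k; exists l.
  have [|_ _ [l0 [? ?] _]] := min_cvg l (fun k => (lP k).1); last by exists l0.
  by under eq_fun do rewrite (lP _).2.
- move=> l Ll Il; have [phi hphi [l0 [? _] ?]] := min_cvg l Ll Il.
  by exists phi => //; exists l0.
- move=> l Ll [_ lmin]; split=> // x Lx.
  by have := lmin x (subset_closure Lx); rewrite !extensionE.
Qed.

End bilevel.

Theorem corollary2p8 (R : realType) (n N : nat)
    (Omega : set 'rV[R]_n) (oOmega : open Omega) (bOmega : bounded_set Omega)
    (uc ueta : 'I_N -> L2 oOmega)
    (X : topologicalType) (X1 : first_countable X)
    (Lam : set X) (Lam0 : Lam !=set0) (cLam : compact (closure Lam))
    (Reg : X -> L2 oOmega -> \bar R)
    (Reg_ge0 : forall l, Lam l -> forall u, (0 <= Reg l u)%E)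
    (Reg_lsc : forall l, Lam l -> weak_lsc (Reg l))
    (Reg_proper : forall l, Lam l -> [set v | (Reg l v < +oo)%E] !=set0)
    (Jbar : X -> 'I_N -> L2 oOmega -> \bar R)
    (JbarE : forall l, closure Lam l -> forall j,
      lim_along (@gamma_lim _ _ _ _) Lam
        (fun l' => denoising ueta (Reg l') j) l (Jbar l j))
    (Rbar : X -> L2 oOmega -> \bar R)
    (RbarE : forall l, closure Lam l ->
      lim_along (@mosco_lim _ _ _ _) Lam Reg l (Rbar l))
    (Kbar1 : forall l, (closure Lam `\` Lam) l ->
      exists w, minimizers (Jbar l) = [set w]) :
  let I l := upper_level uc (denoising ueta (Reg l)) in
  let Ibar l := upper_level uc (Jbar l) in
  [/\ exists2 l, argmin (closure Lam) Ibar l &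
        Ibar l = ereal_inf [set I l' | l' in Lam],
      forall l : nat -> X, (forall k, Lam (l k)) ->
        I (l k) @[k --> \oo] --> ereal_inf [set I l' | l' in Lam] ->
        exists2 phi : nat -> nat, {homo phi : i j / (i < j)%N} &
          exists2 lim_l, argmin (closure Lam) Ibar lim_l &
            l (phi k) @[k --> \oo] --> lim_l
    & forall l, Lam l -> argmin (closure Lam) Ibar l -> argmin Lam I l].
Proof.
exact: (@bilevel_extension _ _ _ _ _ uc ueta _ X1 Lam Reg Reg_ge0 Reg_lsc
  Reg_proper Jbar JbarE Rbar RbarE Kbar1 Lam0 cLam).
Qed.
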